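(* For each positive integer $e$ there exists $N$ such that for all integers $n > N$, \[ \mathcal C_e(\mathsf U_n) = \left\{ \left(\overline{a_2}^{(e)},\overline{a_3}^{(e)},\dots,\overline{a_e}^{(e)}\right) : a_i \in \mathbb Z \text{ and } 2^{i-1} \text{ divides } a_i \text{ for each } i = 2,\dots,e \right\}. \]
   Context: For $a\in\mathbb Z$ and a positive integer $e$, $\overline{a}^{(e)}$ denotes the residue class of $a$ modulo $2^e$. $\mathsf U_n$ is the set of $n\times n$ matrices with all entries in $\{1,-1\}$ and all diagonal entries equal to $1$. For a set $\mathsf M_n$ of $n\times n$ integer matrices, $\mathcal C_e(\mathsf M_n)$ is the set of tuples $\left(\overline{a_2}^{(e)},\dots,\overline{a_e}^{(e)}\right)$ such that $\det(xI-M)=\sum_{i=0}^n a_i x^{n-i}$ for some $M\in\mathsf M_n$ (with $a_i:=0$ for $i>n$). *)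

(* Defs.v *)
From mathcomp Require Import all_boot all_algebra.
From mathcomp Require Import boolp classical_sets.

Set Implicit Arguments.
Unset Strict Implicit.
Unset Printing Implicit Defensive.

Import GRing.Theory.
Local Open Scope ring_scope.
Local Open Scope classical_set_scope.

(* 'Z_m is the ring of integers modulo m only for m >= 2; here m = 2 ^ e with
   e positive. *)
Definition residue (e : nat) (a : int) : 'Z_(2 ^ e) := a%:~R.

(* The entry at position k : 'I_e.-1 is the residue class of a_(k+2). *)
Definition residue_tuple (e : nat) (a : nat -> int) : (e.-1).-tuple 'Z_(2 ^ e) :=
  [tuple residue e (a k.+2) | k < e.-1].

(* The coefficient of x ^ (n - i) in det (x I - M); subtraction on nat is
   truncated, so i > n has to be treated separately. *)
Definition charcoef (n : nat) (M : 'M[int]_n) (i : nat) : int :=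
  if (i <= n)%N then (char_poly M)`_(n - i) else 0.

Definition sfU (n : nat) : set 'M[int]_n :=
  [set M | (forall i j, M i j = 1 \/ M i j = -1) /\ (forall i, M i i = 1)].

Definition calC (e n : nat) (Mn : set 'M[int]_n) : set ((e.-1).-tuple 'Z_(2 ^ e)) :=
  [set residue_tuple e (charcoef M) | M in Mn].
Arguments calC e {n} Mn _.
Arguments sfU n _ : clear implicits.

(* Main.v *)
Require Import Defs.
From mathcomp Require Import all_boot all_algebra.
From mathcomp Require Import boolp classical_sets.
From mathcomp Require Import zify ring.

Set Implicit Arguments.
Unset Strict Implicit.
Unset Printing Implicit Defensive.

Import GRing.Theory.
Local Open Scope ring_scope.
Local Open Scope classical_set_scope.

(* Write M = J - 2B, where B is a 0/1 matrix and J = u v is the all-ones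
   matrix, of rank one. The identity det(A + u v) = det A + v adj(A) u and the
   expansion of adj(x I - B) in powers of B give
     a_(k+1) = (-2)^k (-2 b_(k+1) - sum_(j <= k) b_(k-j) w_j),
   where det(x I - B) = sum_i b_i x^(n-i) and w_j = v B^j u; hence 2^k divides
   a_(k+1). If B is strictly triangular, then b_0 = 1 is the only nonzero b_i
   and a_(k+1) = - (-2)^k w_k. If moreover B is the matrix of a forest with
   edges from each vertex to its parent, then a walk with k edges starts at a
   vertex iff its depth is at least k, and it is unique: w_k is the number of
   these vertices. Appending vertices of depth at most K to a path on K + 1
   vertices realizes all residues of w_1, ..., w_K. *)

Lemma det_rank1D_lreg (R : comNzRingType) n (A : 'M[R]_n) (u : 'cV_n)
    (v : 'rV_n) :
  GRing.lreg (\det A) ->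
  \det (A + u *m v) = \det A + (v *m \adj A *m u) 0 0.
Proof.
move=> reg_detA; pose C := block_mx A (- u) v 1%:M.
have clear_row :
    C *m block_mx 1%:M 0 (- v) 1%:M = block_mx (A + u *m v) (- u) 0 1%:M.
  by rewrite mulmx_block !mulmx1 !mulmx0 mulNmx mulmxN opprK mul1mx subrr
    !add0r.
have clear_col :
    C *m block_mx 1%:M (\adj A *m u) 0 (\det A)%:M =
    block_mx A 0 v (v *m \adj A *m u + (\det A)%:M).
  rewrite mulmx_block !mulmx1 !mulmx0 !addr0 mul1mx !mulmxA mul_mx_adj.
  by rewrite mulNmx mul_mx_scalar mul_scalar_mx subrr.
apply: reg_detA; rewrite [LHS]mulrC; move/(congr1 determinant): clear_row.
rewrite det_mulmx det_lblock det_ublock !det1 !mulr1 => <-.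
move/(congr1 determinant): clear_col.
rewrite det_mulmx det_lblock det_ublock det1 mul1r det_scalar1 => ->.
by rewrite det_mx11 !mxE eqxx addrC.
Qed.

Lemma map_horner_eval_polyC (R : comNzRingType) m n (A : 'M[R]_(m, n)) a :
  map_mx (horner_eval a) (map_mx polyC A) = A.
Proof. by apply/matrixP => i j; rewrite !mxE /= horner_evalE hornerC. Qed.

(* Over [{poly R}] the determinant of ['X + A] is monic, hence regular; the
   general case is its value at [0]. *)
Lemma det_rank1D (R : comNzRingType) n (A : 'M[R]_n) (u : 'cV_n) (v : 'rV_n) :
  \det (A + u *m v) = \det A + (v *m \adj A *m u) 0 0.
Proof.
pose XA := char_poly_mx (- A).
have XA_at0 : map_mx (horner_eval 0) XA = A.
  rewrite map_mxB map_scalar_mx map_horner_eval_polyC /=.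
  by rewrite horner_evalE hornerX raddf0 sub0r opprK.
have /(congr1 (horner_eval 0)) :=
  det_rank1D_lreg (map_mx polyC u) (map_mx polyC v)
    (monic_lreg (char_poly_monic (- A))).
rewrite rmorphD -!det_map_mx map_mxD map_mxM XA_at0 !map_horner_eval_polyC.
move=> ->; congr (_ + _).
transitivity (map_mx (horner_eval 0)
  (map_mx polyC v *m \adj XA *m map_mx polyC u) 0 0); first by rewrite [RHS]mxE.
by rewrite !map_mxM map_mx_adj XA_at0 !map_horner_eval_polyC.
Qed.

Lemma coef_adj_char_poly_mx_rec (R : comNzRingType) n (A : 'M[R]_n) i :
  map_mx (coefp i) (\adj (char_poly_mx A)) =
  ((char_poly A)`_i.+1)%:M +
    A *m map_mx (coefp i.+1) (\adj (char_poly_mx A)).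
Proof.
have := mul_mx_adj (char_poly_mx A); rewrite mulmxBl mul_scalar_mx.
move/(canRL (subrK _)) => mulXadj; apply/matrixP => r c.
have /(congr1 (coefp i.+1)) := congr1 (fun B => fun_of_matrix B r c) mulXadj.
rewrite !mxE /= coefXM /= coefD coefMn => ->; congr (_ + _).
by rewrite coef_sum; apply: eq_bigr => k _; rewrite !mxE coefCM.
Qed.

Lemma coef_adj_char_poly_mx (R : comNzRingType) n (A : 'M[R]_n) i :
  map_mx (coefp i) (\adj (char_poly_mx A)) =
  \sum_(j < n - i) (char_poly A)`_(i + j).+1 *: A ^+ j.
Proof.
have [d vanish] : exists d, forall l, (d <= l)%N ->
    map_mx (coefp l) (\adj (char_poly_mx A)) = 0.
  exists (\max_(rc : 'I_n * 'I_n) size (\adj (char_poly_mx A) rc.1 rc.2)).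
  move=> l le_dl; apply/matrixP => r c; rewrite [LHS]mxE [RHS]mxE.
  exact/nth_default/(leq_trans _ le_dl)/(leq_bigmax (r, c)).
have [m] : exists m, (maxn d n <= i + m)%N.
  by exists (maxn d n); exact: leq_addl.
elim: m i => [|m IHm] i.
  rewrite addn0 geq_max => /andP[le_di le_ni].
  by rewrite vanish // (eqP le_ni) big_ord0.
rewrite -addSnnS => /IHm IH; rewrite coef_adj_char_poly_mx_rec IH {IH}.
have [lt_in|le_ni] := ltnP i n.
  rewrite -(subnSK lt_in) big_ord_recl addn0 expr0 scalemx1 mulmx_sumr.
  by congr (_ + _); apply: eq_bigr => j _; rewrite -scalemxAr exprS addnS.
rewrite (eqP le_ni) (eqP (leqW le_ni)) !big_ord0 mulmx0 addr0.
by rewrite nth_default ?scale0r // ?size_char_poly // raddf0.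
Qed.

Lemma coef_char_poly_rank1D (R : comNzRingType) n (A : 'M[R]_n) (u : 'cV_n)
    (v : 'rV_n) i :
  (char_poly (A + u *m v))`_i = (char_poly A)`_i -
    \sum_(j < n - i) (char_poly A)`_(i + j).+1 * (v *m A ^+ j *m u) 0 0.
Proof.
have -> : char_poly (A + u *m v) =
    \det (char_poly_mx A + map_mx polyC (- u) *m map_mx polyC v).
  congr (\det _).
  by rewrite -map_mxM mulNmx map_mxN /char_poly_mx map_mxD opprD addrA.
rewrite det_rank1D coefD; congr (_ + _).
transitivity ((v *m map_mx (coefp i) (\adj (char_poly_mx A)) *m - u) 0 0).
  rewrite !mxE coef_sum; apply: eq_bigr => r _.
  rewrite !mxE coefMC coef_sum; congr (_ * _); apply: eq_bigr => c _.
  by rewrite !mxE coefCM.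
rewrite coef_adj_char_poly_mx mulmxN mulmx_sumr mulmx_suml !mxE summxE.
by congr (- _); apply: eq_bigr => j _; rewrite -scalemxAr -scalemxAl mxE.
Qed.

Lemma coef_comp_scaleX (R : comNzRingType) (p : {poly R}) a i :
  (p \Po (a *: 'X))`_i = a ^+ i * p`_i.
Proof.
rewrite comp_polyE; under eq_bigr do rewrite exprZn scalerA.
rewrite -(poly_def _ (fun k => p`_k * a ^+ k)) coef_poly [RHS]mulrC.
by case: ltnP => // le_size; rewrite nth_default ?mul0r.
Qed.

Lemma coef_char_polyZ_lreg (R : comNzRingType) n (A : 'M[R]_n) a i :
  GRing.lreg a ->
  (char_poly (a *: A))`_i = a ^+ (n - i) * (char_poly A)`_i.
Proof.
move=> reg_a; have [lt_ni|le_in] := ltnP n i.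
  by rewrite !nth_default ?mulr0 ?size_char_poly.
have scaleX : char_poly (a *: A) \Po (a *: 'X) = a%:P ^+ n * char_poly A.
  rewrite -[_ \Po _]/(comp_poly _ _) -det_map_mx -detZ.
  congr (\det _); apply/matrixP => r c; rewrite !mxE raddfB raddfMn /=.
  by rewrite comp_polyX comp_polyC mulrBr mulrnAr polyCM !mul_polyC.
apply: (lregX (n := i) reg_a); move/(congr1 (coefp i)): scaleX.
by rewrite /= coef_comp_scaleX -polyC_exp coefCM mulrA -exprD subnKC.
Qed.

(* The scalar ['X] is regular; specialize it to [a]. *)
Lemma coef_char_polyZ (R : comNzRingType) n (A : 'M[R]_n) a i :
  (char_poly (a *: A))`_i = a ^+ (n - i) * (char_poly A)`_i.
Proof.
have /(congr1 (horner_eval a)) :=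
  coef_char_polyZ_lreg (map_mx polyC A) i (monic_lreg (monicX R)).
rewrite -coef_map map_char_poly map_mxZ map_horner_eval_polyC.
rewrite -map_char_poly coef_map /= !horner_evalE hornerX => ->.
by rewrite hornerM hornerXn hornerC.
Qed.

Lemma exprmxZn (R : comPzRingType) n (A : 'M[R]_n) a k :
  (a *: A) ^+ k = a ^+ k *: A ^+ k.
Proof.
elim: k => [|k IHk]; first by rewrite !expr0 scale1r.
by rewrite !exprS IHk -mulmxE -scalemxAr -scalemxAl scalerA mulrC.
Qed.

Lemma coef_char_polyZ_rank1D (R : comNzRingType) n (A : 'M[R]_n) a (u : 'cV_n)
    (v : 'rV_n) i : (i < n)%N ->
  (char_poly (a *: A + u *m v))`_i =
  a ^+ (n - i.+1) * (a * (char_poly A)`_i -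
    \sum_(j < n - i) (char_poly A)`_(i + j).+1 * (v *m A ^+ j *m u) 0 0).
Proof.
move=> lt_in; rewrite coef_char_poly_rank1D coef_char_polyZ.
rewrite mulrBr mulrA -exprSr subnSK // mulr_sumr; congr (_ - _).
apply: eq_bigr => j _; rewrite exprmxZn -scalemxAr -scalemxAl [in LHS]mxE.
rewrite coef_char_polyZ mulrCA !mulrA -exprD; congr (_ ^+ _ * _ * _).
have := ltn_ord j; lia.
Qed.

Definition walk_count (R : pzSemiRingType) n (B : 'M[R]_n) k : R :=
  (const_mx 1 *m B ^+ k *m const_mx 1 : 'M_1) 0 0.

Lemma charcoef_const1_sub_double n (B : 'M[int]_n) k : (k < n)%N ->
  charcoef (const_mx 1 - 2 *: B) k.+1 =
  (- 2) ^+ k * (- 2 * (char_poly B)`_(n - k.+1) -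
    \sum_(j < k.+1) (char_poly B)`_(n - k.+1 + j).+1 * walk_count B j).
Proof.
move=> lt_kn.
have ones : const_mx 1 = const_mx 1 *m (const_mx 1 : 'rV_n) :> 'M[int]_n.
  by apply/matrixP => i j; rewrite !mxE big_ord1 !mxE mulr1.
rewrite /charcoef lt_kn {1}ones -scaleNr addrC.
rewrite coef_char_polyZ_rank1D; last by lia.
by rewrite subnSK // !subKn // ltnW.
Qed.

Lemma charcoef_sfU_dvd n (M : 'M[int]_n) i : sfU n M ->
  ((2 ^ (i - 1))%N%:Z %| charcoef M i)%Z.
Proof.
case: i => [|k] [M1 _]; [exact: dvd1z | rewrite subn1 /=].
have [le_nk|lt_kn] := leqP n k; first by rewrite /charcoef ltnNge le_nk dvdz0.
pose B : 'M[int]_n := \matrix_(r, c) (M r c == -1)%:R.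
have -> : M = const_mx 1 - 2 *: B.
  by apply/matrixP => r c; rewrite !mxE; case: (M1 r c) => ->.
rewrite charcoef_const1_sub_double // exprNn mulrAC dvdz_mull //.
by rewrite -natz natrX.
Qed.

(* A forest is encoded by its depth function: the parent of [i] is the vertex
   [(d i).-1], which must have depth [(d i).-1]; roots have depth 0. *)
Definition self_leveled (d : nat -> nat) := forall i j, (j < d i)%N -> d j = j.

Definition parent_mx (R : pzSemiRingType) n (d : nat -> nat) : 'M[R]_n :=
  \matrix_(i, j) (d i == j.+1)%:R.

Section ForestMatrix.

Variables (R : comNzRingType) (n : nat) (d : nat -> nat).
Hypothesis d_lev : self_leveled d.

Let B := parent_mx R n d.

Lemma self_leveled_le i : (d i <= i)%N.
Proof. by rewrite leqNgt; apply/negP => lt_id; have := d_lev lt_id; lia. Qed.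

Lemma char_poly_parent_mx : char_poly B = 'X^n.
Proof.
have strictly_lower (i j : 'I_n) : (i <= j)%N -> B i j = 0.
  move=> le_ij; rewrite mxE (_ : _ == _ = false) //.
  by have := self_leveled_le i; lia.
rewrite char_poly_trig; last first.
  by apply/is_trig_mxP => i j /ltnW; exact: strictly_lower.
under eq_bigr do rewrite strictly_lower // subr0.
by rewrite prodr_const card_ord.
Qed.

Lemma parent_mxX_const1 k : B ^+ k *m const_mx 1 = \col_i (k <= d i)%:R.
Proof.
elim: k => [|k IHk]; first by rewrite mul1mx; apply/matrixP=> i j; rewrite !mxE.
rewrite exprS -mulmxE -mulmxA IHk; apply/matrixP => i j; rewrite !mxE.
under eq_bigr => l _ do rewrite !mxE.
case def_di: (d i) => [|p].
  by rewrite big1 // => l _; rewrite mul0r.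
have lt_pn : (p < n)%N by have := self_leveled_le i; have := ltn_ord i; lia.
rewrite (bigD1 (Ordinal lt_pn)) //= eqxx mul1r big1 ?addr0 => [|l ne_lp].
  by rewrite (d_lev (i := i)) ?def_di.
by rewrite eqSS eq_sym (_ : _ == _ = false) ?mul0r //; apply: negbTE.
Qed.

Lemma walk_count_parent_mx k : walk_count B k = (\sum_(i < n) (k <= d i))%:R.
Proof.
rewrite /walk_count -mulmxA parent_mxX_const1 mxE natr_sum.
by apply: eq_bigr => i _; rewrite !mxE mul1r.
Qed.

End ForestMatrix.

Lemma charcoef_parent_mx n d k : self_leveled d -> (k < n)%N ->
  charcoef (const_mx 1 - 2 *: parent_mx int n d) k.+1 =
  2 ^+ k * ((- 1) ^+ k.+1 * (\sum_(i < n) (k <= d i))%:R).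
Proof.
move=> d_lev lt_kn.
rewrite charcoef_const1_sub_double // char_poly_parent_mx //.
rewrite big_ord_recr big1 /= => [|j _]; last first.
  rewrite coefXn (_ : (_ == n) = false) ?mul0r //.
  by have := ltn_ord j; lia.
have -> : (n - k.+1 + k).+1 = n by lia.
rewrite !coefXn eqxx (_ : (_ == n) = false); last by lia.
rewrite mulr0 mul1r walk_count_parent_mx // exprNn exprS; ring.
Qed.

Lemma sfU_parent_mx n d : self_leveled d ->
  sfU n (const_mx 1 - 2 *: parent_mx int n d).
Proof.
move=> d_lev; split=> [i j|i]; rewrite !mxE.
  by case: (_ == _); [right | left].
by rewrite (_ : _ == _ = false) //; have := self_leveled_le d_lev i; lia.
Qed.

Lemma sum_nth_count (T : Type) (x0 : T) (a : pred T) s n :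
  ~~ a x0 -> (size s <= n)%N ->
  (\sum_(i < n) a (nth x0 s i))%N = count a s.
Proof.
move=> a_x0; elim: s n => [|x s IHs] [|n] //= le_sn.
- by rewrite big_ord0.
- by rewrite big1 // => i _; rewrite nth_nil (negPf a_x0).
- by rewrite big_ord_recl IHs.
Qed.

Lemma count_leq_surj m K (f : nat -> 'Z_m) : exists t : seq nat,
  [/\ (size t <= K * #|{: 'Z_m}|)%N, all (leq^~ K) t
    & forall k, (0 < k <= K)%N -> (count (leq k) t)%:R = f k].
Proof.
elim: K f => [|K IHK] f; first by exists [::]; split=> // k; case: k.
have [t [size_t t_le t_f]] := IHK (fun k => f k - f K.+1).
exists (nseq (f K.+1) K.+1 ++ t); split.
- by rewrite size_cat size_nseq mulSn leq_add // card_ord ltnW.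
- rewrite all_cat all_nseq leqnn orbT /=.
  by apply: sub_all t_le => x; exact: leqW.
- move=> k /andP[k_gt0 le_k].
  rewrite count_cat count_nseq le_k mul1n natrD natr_Zp.
  have [le_kK|lt_Kk] := leqP k K; first by rewrite t_f ?k_gt0 // addrC subrK.
  have -> : k = K.+1 by lia.
  have count_t : count (leq K.+1) t = 0%N.
    rewrite -(count_pred0 t); apply: eq_in_count => x /(allP t_le) le_xK.
    by rewrite ltnNge le_xK.
  by rewrite count_t addr0.
Qed.

Lemma level_count_surj m K (f : nat -> 'Z_m) :
  exists2 d, self_leveled d &
    forall n k, (K.+1 + K * #|{: 'Z_m}| <= n)%N -> (0 < k <= K)%N ->
      (\sum_(i < n) (k <= d i))%:R = f k.
Proof.
have [t [size_t t_le t_f]] :=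
  count_leq_surj K (fun k => f k - (count (leq k) (iota 0 K.+1))%:R).
pose s := iota 0 K.+1 ++ t.
have s_le : all (leq^~ K) s.
  by rewrite all_cat t_le andbT; apply/allP => x; rewrite mem_iota.
have nth_s_le i : (nth 0 s i <= K)%N.
  by have [/(all_nthP 0%N s_le)|/(nth_default 0%N)->] := ltnP i (size s).
exists (nth 0%N s) => [i j lt_j | n k le_n /andP[k_gt0 le_kK]].
  have le_jK : (j < K.+1)%N by have := nth_s_le i; lia.
  by rewrite nth_cat size_iota le_jK nth_iota.
rewrite sum_nth_count -?ltnNge //; last first.
  by rewrite size_cat size_iota; apply: leq_trans le_n; rewrite leq_add2l.
by rewrite count_cat natrD t_f ?k_gt0 // addrC subrK.
Qed.

Theorem theorem1p2 (e : nat) (e_gt0 : (0 < e)%N) :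
  exists N : nat, forall n : nat, (N < n)%N ->
    calC e (sfU n) =
    [set residue_tuple e a | a in
      [set a : nat -> int |
        forall i : nat, (2 <= i <= e)%N -> ((2 ^ (i - 1))%N%:Z %| a i)%Z]].
Proof.
exists (e.+1 + e * #|{: 'Z_(2 ^ e)}|)%N => n lt_n; apply/seteqP; split=> t /=.
  move=> [M UM <-]; exists (charcoef M) => // i _.
  exact: charcoef_sfU_dvd.
move=> [a a_dvd <-]; pose b k := (a k.+1 %/ 2 ^+ k)%Z.
have aE k : (0 < k < e)%N -> a k.+1 = 2 ^+ k * b k.
  move=> /andP[k_gt0 lt_ke]; rewrite mulrC divzK //.
  by have := a_dvd k.+1; rewrite subn1 -natz natrX; apply; lia.
have [d d_lev d_count] :=
  level_count_surj e (fun k => ((- 1) ^+ k.+1 * b k)%:~R : 'Z_(2 ^ e)).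
exists (const_mx 1 - 2 *: parent_mx int n d); first exact: sfU_parent_mx.
apply: eq_from_tnth => k; rewrite !tnth_mktuple /residue.
have lt_k := ltn_ord k; rewrite charcoef_parent_mx ?aE //; [|lia..].
rewrite [LHS]intrM [X in _ * X = _]intrM rmorph_nat d_count; [|lia..].
by rewrite -!intrM signrMK.
Qed.
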